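(* Let $r$ and $s$ be positive integers with $r \geq 2$ and $s$ odd. Then the additive group $\left( \mathbf{Z} \times (\mathbf{Z}/2\mathbf{Z}) \right)^{[r/2]}$ has an infinite generating set $A$ with phase transition $(r,s)$.
   Context: $[r/2]$ denotes the integer part of $r/2$, and $H^{n}$ denotes the direct product of $n$ copies of $H$. A subset $A$ of an additive abelian group $G$ is a generating set for $G$ if every element of $G$ is a finite sum of elements of $A \cup (-A)$, where $-A = \{-a : a \in A\}$ and the empty sum is $0$. For $x \in G$, the word length $\ell_A(x)$ is the smallest integer $k \ge 0$ such that $x$ is a sum of $k$ elements of $A \cup (-A)$ (repetitions allowed). For every nonnegative integer $k$, $S_A(k) = \{x \in G : \ell_A(x) = k\}$ and $L_A(k) = |S_A(k)| \in \{0,1,2,\ldots\} \cup \{\infty\}$. If $A$ is an infinite generating set for $G$ such that $L_A(r') = 0$ for some integer $r'\ge 0$, let $r$ be the largest integer such that $L_A(r) > 0$ and let $s = L_A(r) = |S_A(r)|$; the ordered pair $(r,s)$ is called the phase transition of $A$. *)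

(* Defs.v *)
From HB Require Import structures.
From mathcomp Require Import all_boot all_order all_algebra finmap.
From mathcomp Require Import boolp classical_sets functions cardinality.
Set Implicit Arguments.
Unset Strict Implicit.
Unset Printing Implicit Defensive.
Import Order.TTheory GRing.Theory Num.Theory.
Local Open Scope ring_scope.
Local Open Scope classical_set_scope.

Section WordLength.
Context {G : zmodType}.
Implicit Types (A : set G) (x : G) (k r : nat).

Definition sum_of A k x : Prop :=
  exists a : 'I_k -> G,
    (forall i, (A `|` [set - b | b in A]) (a i)) /\ x = \sum_(i < k) a i.

Definition generating_set A : Prop := forall x, exists k, sum_of A k x.

(* The graph of the word length: an element that is no sum of elements of
   A and -A has no length at all. *)
Definition has_word_length A x k : Prop :=
  sum_of A k x /\ forall j, sum_of A j x -> (k <= j)%N.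

Definition sphere A k : set G := [set x | has_word_length A x k].

(* [None] is the value infinity. The finiteness test is needed because
   [fset_set] of an infinite set is empty. *)
Definition sphere_card A k : option nat :=
  if `[< finite_set (sphere A k) >] then Some #|` fset_set (sphere A k)|%fset
  else None.

Definition phase_transition A r (s : option nat) : Prop :=
  [/\ infinite_set A,
      generating_set A,
      exists r', sphere_card A r' = Some 0%N,
      sphere_card A r <> Some 0%N
        /\ (forall k, sphere_card A k <> Some 0%N -> (k <= r)%N)
    & s = sphere_card A r].

End WordLength.

(* Main.v *)
Require Import Defs.
From mathcomp Require Import all_boot all_order all_algebra.
From mathcomp Require Import classical_sets cardinality.
From mathcomp Require Import finmap boolp zify.
Import GRing.Theory.
Local Open Scope ring_scope.
Local Open Scope classical_set_scope.

(** A word metric can be prescribed through its length function: a symmetric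
    subadditive function [N : G -> nat] that vanishes only at [0], and in which
    every nonzero element can be shortened by an element of norm [1], is the
    word length of the set [N = 1].  Such norms add up over direct products, so
    that maxima add and the numbers of maximisers multiply.  On [Z x Z/2] put
    norm [1] on the [(n, 1)] with [|n| > t], norm [1] (resp. [2]) on the
    [(n, 0)] with [n != 0], and norm [2] (resp. [3]) on the [2t + 1] remaining
    nonzero elements.  A product of one such factor, with [2t + 1 = s], and of
    [[r/2] - 1] factors with maximum [2] and [t = 0] has the maximum [r],
    attained [s] times. *)

Record geodesic_norm {G : zmodType} (N : G -> nat) : Prop := GeodesicNorm {
  gnorm0P : forall x : G, N x = 0%N <-> x = 0;
  gnormN : forall x : G, N (- x) = N x;
  gnormD : forall x y : G, (N (x + y)%R <= N x + N y)%N;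
  gnorm_descent : forall x : G, x <> 0 -> exists a, N a = 1%N /\ (N (x - a)%R < N x)%N
}.

Arguments gnorm0P {G N}.
Arguments gnormN {G N}.
Arguments gnormD {G N}.
Arguments gnorm_descent {G N}.

Section WordLengthOfGeodesicNorm.
Context {G : zmodType} {N : G -> nat} (NP : geodesic_norm N).
Let A : set G := [set a | N a = 1%N].

Lemma unit_sphere_symm a : (A `|` [set - b | b in A]) a <-> N a = 1%N.
Proof.
by split=> [[//|[b Nb <-]]|Na]; [rewrite (gnormN NP) | left].
Qed.

Lemma gnorm_le_sum_of k x : sum_of A k x -> (N x <= k)%N.
Proof.
case=> a [Aa ->].
have N0 : N 0 = 0%N by apply/(gnorm0P NP).
apply: (@leq_trans (\sum_(i < k) N (a i))).
  elim/big_ind2: _ => [|x1 n1 x2 n2 h1 h2|//]; first by rewrite N0.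
  exact: leq_trans (gnormD NP _ _) (leq_add h1 h2).
rewrite (eq_bigr (fun=> 1%N)) ?sum1_card ?card_ord // => i _.
exact/unit_sphere_symm.
Qed.

(** Descent splits off one unit at a time, and subadditivity makes each step lower the norm by
    exactly one, so precisely [N x] summands are used. *)
Lemma sum_of_gnorm x : sum_of A (N x) x.
Proof.
have [k] := ubnP (N x); elim: k x => // k IHk x /ltnSE Nxk.
have [->|/eqP x0] := eqVneq x 0.
  have -> : N 0 = 0%N by apply/(gnorm0P NP).
  by exists (fun=> 0); split=> [[]//|]; rewrite big_ord0.
have [a [Na Nxa]] := gnorm_descent NP _ x0.
have Nx : N x = (N (x - a)%R).+1.
  apply/eqP; rewrite eqn_leq Nxa andbT -addn1 -Na.
  by rewrite -{1}(subrK a x) (gnormD NP).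
have [b [Ab xab]] := IHk _ (leq_trans Nxa Nxk).
(* Prepends [a] to the family [b]: index [0] receives [a], later indices are shifted by one. *)
rewrite Nx; exists (fun i => if unlift ord0 i is Some j then b j else a); split.
  by move=> i; case: unliftP => [j _|_]; [apply: Ab | apply/unit_sphere_symm].
rewrite big_ord_recl unlift_none.
under eq_bigr do rewrite liftK.
by rewrite -xab addrC subrK.
Qed.

Lemma sphere_gnorm k : sphere A k = [set x | N x = k].
Proof.
apply/seteqP; split=> x /=; [case|].
  move=> xk kmin; apply/eqP; rewrite eqn_leq gnorm_le_sum_of //=.
  exact/kmin/sum_of_gnorm.
by move<-; split; [apply: sum_of_gnorm | move=> j; apply: gnorm_le_sum_of].
Qed.

Lemma phase_transition_gnorm r s : infinite_set A -> (0 < s)%N ->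
    (forall x, N x <= r)%N -> ([set x | N x = r] #= `I_s)%card ->
  phase_transition A r (Some s).
Proof.
move=> Ainf s0 Nr rs.
have cardr : sphere_card A r = Some s.
  rewrite /sphere_card sphere_gnorm; case: asboolP => [_|[]].
    by rewrite (card_fset_set rs).
  by exists s.
have cardgt k : (r < k)%N -> sphere_card A k = Some 0%N.
  move=> rk; rewrite /sphere_card.
  have -> : sphere A k = set0.
    rewrite sphere_gnorm -subset0 => x /= Nx.
    by have := Nr x; rewrite Nx leqNgt rk.
  by rewrite fset_set0 cardfs0; case: asboolP => // -[]; apply: finite_set0.
split=> //.
- by move=> x; exists (N x); apply: sum_of_gnorm.
- by exists r.+1; apply: cardgt.
- split; first by rewrite cardr => -[s00]; rewrite s00 in s0.
  by move=> k k0; rewrite leqNgt; apply/negP => /cardgt.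
Qed.

End WordLengthOfGeodesicNorm.

(** For descent, a unit at one nonzero coordinate, extended by [0], has total norm [1] and lowers
    the norm of that coordinate only. *)
Lemma geodesic_norm_ffun (I : finType) (G : zmodType) (N : I -> G -> nat) :
    (forall i, geodesic_norm (N i)) ->
  geodesic_norm (fun x : {ffun I -> G} => (\sum_i N i (x i))%N).
Proof.
move=> NP; have N0 i : N i 0 = 0%N by apply/(gnorm0P (NP i)).
split.
- move=> x; split=> [/eqP|->]; last by rewrite big1 // => i _; rewrite ffunE.
  rewrite sum_nat_eq0 => /forallP x0; apply/ffunP => i; rewrite ffunE.
  exact/(gnorm0P (NP i))/eqP/x0.
- by move=> x; apply: eq_bigr => i _; rewrite ffunE (gnormN (NP i)).
- move=> x y; rewrite -big_split; apply: leq_sum => i _ /=.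
  by rewrite ffunE (gnormD (NP i)).
- move=> x x0.
  have [i /eqP xi0] : exists i, x i != 0.
    apply/existsP; rewrite -negb_forall; apply/negP => /forallP x00; apply: x0.
    by apply/ffunP => i; rewrite ffunE; apply/eqP.
  have [a [Na Nxa]] := gnorm_descent (NP i) _ xi0.
  exists [ffun j => if j == i then a else 0]; split.
    rewrite (bigD1 i) //= ffunE eqxx Na big1 // => j /negPf ji.
    by rewrite ffunE ji.
  rewrite (bigD1 i) //= [ltnRHS](bigD1 i) //= !ffunE eqxx.
  rewrite -addSn leq_add // leq_sum // => j /negPf ji.
  by rewrite !ffunE ji subr0.
Qed.

Definition strip_norm (p : bool) (t : nat) (x : int * 'Z_2) : nat :=
  if x.2 == 0 then (if x.1 == 0 then 0 else 1 + p)%N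
  else if (t < `|x.1|)%N then 1%N else (2 + p)%N.

Lemma Z2_cases (e : 'Z_2) : e = 0 \/ e = 1.
Proof. by case: e => -[|[|//]] lt2; [left | right]; apply: val_inj. Qed.

Lemma strip_norm0 p t n : strip_norm p t (n, 0) = if n == 0 then 0%N else (1 + p)%N.
Proof. by []. Qed.

Lemma strip_norm1 p t n :
  strip_norm p t (n, 1) = if (t < `|n|)%N then 1%N else (2 + p)%N.
Proof. by []. Qed.

Lemma geodesic_strip_norm p t : geodesic_norm (strip_norm p t).
Proof.
have D11 : 1 + 1 = 0 :> 'Z_2 by apply: val_inj.
have N1 : - 1 = 1 :> 'Z_2 by apply: val_inj.
have addE (n m : int) (e f : 'Z_2) : (n, e) + (m, f) = (n + m, e + f) by [].
have oppE (n : int) (e : 'Z_2) : - (n, e) = (- n, - e) by [].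
split.
- move=> [n e]; split=> [|[-> ->]] //.
  case: (Z2_cases e) => ->; rewrite ?strip_norm0 ?strip_norm1.
    by case: eqP => [->|].
  by case: ifP.
- move=> [n e]; rewrite oppE.
  by case: (Z2_cases e) => ->; rewrite ?N1 ?oppr0 ?strip_norm0 ?strip_norm1
    ?oppr_eq0 ?abszN.
- move=> [n e] [m f]; rewrite addE.
  (* Elements over [1] have norm at least [1], and [(n, 0)] with [n != 0] has norm [1 + p]; hence
     [1 + 1 >= 1 + p] and [(1 + p) + 1 >= 2 + p] settle the mixed cases with nonzero summands. *)
  case: (Z2_cases e) => ->; case: (Z2_cases f) => ->;
    rewrite ?D11 ?addr0 ?add0r !(strip_norm0, strip_norm1); case: p;
    repeat case: ifP; lia.
- move=> [n e] x0.
  case: (Z2_cases e) x0 => -> x0.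
    have n0 : n != 0 by apply/eqP => n0; apply: x0; rewrite n0.
    case: p; last first.
      by exists (n, 0); rewrite subrr !strip_norm0 eqxx (negPf n0).
    (* Moving [t + 1] further out on the side of [n] gives a unit, and the remainder, with first
       coordinate [t + 1] up to sign, is a unit too: the norm drops from [2] to [1]. *)
    exists (if 0 <= n then n + t.+1%:Z else n - t.+1%:Z, 1).
    rewrite oppE addE N1 add0r !strip_norm1 strip_norm0 (negPf n0).
    by split; repeat case: ifP; lia.
  case: (boolP (t < `|n|)%N) => tn.
    by exists (n, 1); rewrite subrr strip_norm1 strip_norm0 tn eqxx.
  (* As [n <= t], the remainder [(n - (t + 1), 0)] is nonzero, of norm [1 + p]. *)
  exists (t.+1%:Z, 1).
  rewrite oppE addE N1 D11 !strip_norm1 strip_norm0 (negPf tn).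
  by split; repeat case: ifP; lia.
Qed.

Lemma strip_norm_le p t x : (strip_norm p t x <= 2 + p)%N.
Proof. by rewrite /strip_norm; repeat case: ifP; lia. Qed.

Lemma strip_norm_maxP p t n e :
  strip_norm p t (n, e) = (2 + p)%N <-> e = 1 /\ (`|n| <= t)%N.
Proof.
case: (Z2_cases e) => ->; rewrite ?strip_norm0 ?strip_norm1.
  by split=> [|[]//]; case: ifP; lia.
by case: ltnP => tn; split=> [|[_]] //; lia.
Qed.

(** A strict inequality in one term would make the sums differ. *)
Lemma leq_sum_eq (I : finType) (F M : I -> nat) : (forall i, F i <= M i)%N ->
  (\sum_i F i)%N = (\sum_i M i)%N -> forall i, F i = M i.
Proof.
move=> FM FMsum i; have /leqif_sum : forall j, true -> (F j <= M j ?= iff (F j == M j))%N.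
  by move=> j _; split.
by case=> _; rewrite FMsum eqxx => /esym/forallP/(_ i)/eqP.
Qed.

Theorem theorem5 (r s : nat) (hr : (2 <= r)%N) (hs : (0 < s)%N) (sodd : odd s) :
  exists A : set {ffun 'I_(r./2) -> (int * 'Z_2)%type},
    [/\ infinite_set A, generating_set A & phase_transition A r (Some s)].
Proof.
have r2 : (0 < r./2)%N by rewrite half_gt0.
pose i0 : 'I_(r./2) := Ordinal r2.
(* Only the factor [i0] is adjusted: its maximum is raised to [3] when [r] is odd, and its width
   gives [2 * s./2 + 1 = s] maximisers because [s] is odd. Any other factor has the single maximiser
   [(0, 1)]. *)
pose p i := (i == i0) && odd r.
pose t i := if i == i0 then s./2 else 0%N.
pose N (x : {ffun 'I_(r./2) -> (int * 'Z_2)%type}) :=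
  (\sum_i strip_norm (p i) (t i) (x i))%N.
have NP : geodesic_norm N.
  by apply: (geodesic_norm_ffun _ _ (fun i => strip_norm (p i) (t i))) => i;
    apply: geodesic_strip_norm.
have maxE : (\sum_i (2 + p i))%N = r.
  rewrite big_split /= sum_nat_const card_ord (bigD1 i0) //= big1 => [|i /negPf ii0].
    by rewrite /p eqxx addn0 -[in RHS](odd_double_half r) addnC -muln2.
  by rewrite /p ii0.
have Ninf : infinite_set [set x | N x = 1%N].
  (* The shift by [s > 0] puts the coordinate at [i0] beyond [s./2], where the norm is [1]. *)
  pose f (n : nat) : {ffun 'I_(r./2) -> (int * 'Z_2)%type} :=
    [ffun i => if i == i0 then ((n + s)%N%:Z, 1) else 0].
  have finj : injective f.
    by move=> n m /ffunP/(_ i0); rewrite !ffunE eqxx => -[/addIn].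
  apply: (@sub_infinite_set _ (range f)).
    move=> _ [n _ <-] /=; rewrite /N (bigD1 i0) //= ffunE eqxx /t eqxx strip_norm1.
    rewrite big1 => [|i /negPf ii0]; last by rewrite ffunE ii0.
    by case: ifP; lia.
  rewrite (eq_finite_set (inj_card_eq (in2W finj))).
  exact: infinite_nat.
have NE : ([set x | N x = r] #= `I_s)%card.
  (* For [n < s], [n - s./2] runs through the [s] integers of absolute value at most [s./2]. *)
  pose f (n : nat) : {ffun 'I_(r./2) -> (int * 'Z_2)%type} :=
    [ffun i => (if i == i0 then n%:Z - s./2%:Z else 0, 1)].
  have finj : injective f.
    by move=> n m /ffunP/(_ i0); rewrite !ffunE eqxx => -[/addIr[]].
  have -> : [set x | N x = r] = f @` `I_s.
    apply/seteqP; split=> x /=.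
      (* The factor maxima add up to [r], so every coordinate must attain its own. *)
      move=> Nx; have xmax := leq_sum_eq _ _ _
        (fun i => strip_norm_le (p i) (t i) (x i)) (etrans Nx (esym maxE)).
      have {}xmax i : (x i).2 = 1 /\ (`|(x i).1| <= t i)%N.
        by apply/(strip_norm_maxP (p i)); rewrite -surjective_pairing.
      have [_] := xmax i0; rewrite /t eqxx => xi0.
      (* The integer is nonnegative by [xi0]; the absolute value only makes it a natural number. *)
      exists `|((x i0).1 + s./2%:Z)%R|%N; first by rewrite /=; lia.
      apply/ffunP => i; rewrite ffunE; have [] := xmax i; rewrite /t.
      rewrite [x i]surjective_pairing /= => ->.
      case: (i =P i0) => [->|_] xi; congr (_, _); lia.
    case=> n ns <-; apply: etrans maxE; apply: eq_bigr => i _; rewrite ffunE.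
    by apply/strip_norm_maxP; split=> //; rewrite /t; case: ifP => _; lia.
  exact: inj_card_eq (in2W finj).
have PT : phase_transition [set x | N x = 1%N] r (Some s).
  apply: phase_transition_gnorm => // x; rewrite -[leqRHS]maxE.
  by apply: leq_sum => i _; apply: strip_norm_le.
by exists [set x | N x = 1%N]; case: (PT).
Qed.
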